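(* Let $G$ be a finite simple connected graph, let $\lambda$ be an eigenvalue of the normalized Laplacian $\mathcal{L}$ of $G$, and let $\{x,y\}$ be an edge of $G$. Then the edge derivative of $\lambda$ with respect to $\{x,y\}$ satisfies $$-\lambda \le \frac{d\lambda}{d\{x,y\}} \le 2-\lambda .$$ Moreover, both bounds are tight: there exist a finite simple connected graph, an eigenvalue of its normalized Laplacian and an edge for which equality holds in the lower bound, and likewise there exist such a graph, eigenvalue and edge for which equality holds in the upper bound.
   Context: For a finite simple connected graph $G$ with at least two vertices, $A$ is the adjacency matrix, $d_x$ is the degree of the vertex $x$, $D$ is the diagonal matrix of degrees (invertible), and the normalized Laplacian is $\mathcal{L} = I - D^{-1/2} A D^{-1/2}$. Edge derivative: let $\lambda$ be an eigenvalue of $\mathcal{L}$ of multiplicity $k$, let $\mathbf{v}_1,\dots,\mathbf{v}_k$ be an orthonormal basis of the $\lambda$-eigenspace, and write $\mathbf{v}_{i,x}$ for the entry of $\mathbf{v}_i$ at the vertex $x$. For a pair $\{x,y\}$ of distinct vertices (adjacent or not), $$\frac{d\lambda}{d\{x,y\}} = \frac1k\sum_{i=1}^k\left[(1-\lambda)\left(\frac{\mathbf{v}_{i,x}^2}{d_x}+\frac{\mathbf{v}_{i,y}^2}{d_y}\right)-2\,\frac{\mathbf{v}_{i,x}\mathbf{v}_{i,y}}{\sqrt{d_xd_y}}\right].$$ This value does not depend on the choice of the orthonormal basis. (It is the average over $i$ of $\mathbf{v}_i^T \mathcal{L}'(0)\mathbf{v}_i$, where $\mathcal{L}(t)$ is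 the normalized Laplacian of the weighted graph obtained from $G$ by adding $t$ to the weight of the pair $\{x,y\}$, edges having weight 1 and non-edges weight 0.) *)

(* Defs.v *)
From mathcomp Require Import all_boot all_order all_algebra.
Set Implicit Arguments.
Unset Strict Implicit.
Unset Printing Implicit Defensive.
Import Order.TTheory GRing.Theory Num.Theory.
Local Open Scope ring_scope.

Definition simple_connected_graph (n : nat) (e : rel 'I_n) : Prop :=
  [/\ (1 < n)%N, symmetric e, irreflexive e & forall x y, connect e x y].

Definition degree (n : nat) (e : rel 'I_n) (x : 'I_n) : nat :=
  #|[set y | e x y]|.

Section NormalizedLaplacian.
Variables (R : rcfType) (n : nat) (e : rel 'I_n).

Definition adjacency_mx : 'M[R]_n := \matrix_(x, y) (e x y)%:R.

Definition inv_sqrt_degree_mx : 'M[R]_n :=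
  diag_mx (\row_x (Num.sqrt (degree e x)%:R)^-1).

Definition normalized_laplacian : 'M[R]_n :=
  1%:M - inv_sqrt_degree_mx *m adjacency_mx *m inv_sqrt_degree_mx.

(* MathComp's [eigenvalue] and [eigenspace] refer to row eigenvectors, acted on
   from the right; by symmetry these are the transposes of the column ones. *)
Lemma normalized_laplacian_sym :
  symmetric e -> normalized_laplacian^T = normalized_laplacian.
Proof.
move=> esym; rewrite /normalized_laplacian linearB /= trmx1 !trmx_mul tr_diag_mx.
rewrite mulmxA; congr (_ - _ *m _ *m _).
by apply/matrixP=> x y; rewrite !mxE esym.
Qed.

End NormalizedLaplacian.

Section OrthonormalBasis.
Variables (R : rcfType) (n : nat).

(* The rows of V form an orthonormal basis of the row space of E. *)
Definition orthonormal_basis_of m (E : 'M[R]_(m, n)) k (V : 'M[R]_(k, n)) :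
  bool := (V *m V^T == 1%:M) && (V == E)%MS.

Lemma row_sqr_gt0 (w : 'rV[R]_n) : w != 0 -> 0 < (w *m w^T) 0 0.
Proof.
have sE : (w *m w^T) 0 0 = \sum_j w 0 j ^+ 2.
  by rewrite mxE; apply: eq_bigr => j _; rewrite mxE expr2.
rewrite sE => w0; rewrite lt_def sumr_ge0 ?andbT; last first.
  by move=> j _; rewrite sqr_ge0.
apply: contra w0; rewrite psumr_eq0; last by move=> j _; rewrite sqr_ge0.
move=> /allP h; apply/eqP/rowP => j; rewrite mxE; apply/eqP.
by rewrite -sqrf_eq0; apply: h; rewrite mem_index_enum.
Qed.

Lemma gram_schmidt k (U : 'M[R]_(k, n)) :
  row_free U -> exists V : 'M[R]_(k, n), orthonormal_basis_of U V.
Proof.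
elim: k U => [|k IH] U.
  by move=> _; exists U; rewrite /orthonormal_basis_of submx_refl [_ *m _]flatmx0
     [1%:M]flatmx0 eqxx.
rewrite -[k.+1]/(1 + k)%N in U *; rewrite -[U]vsubmxK.
set u := usubmx U; set U' := dsubmx U => freeU.
have freeU' : row_free U'.
  move: freeU; rewrite -!kermx_eq0 => /eqP kU0.
  apply/eqP/row_matrixP => i; rewrite row0.
  have h : row_mx (0 : 'rV_1) (row i (kermx U')) *m col_mx u U' = 0.
    by rewrite mul_row_col mul0mx add0r -row_mul mulmx_ker row0.
  move/sub_kermxP: h; rewrite kU0 submx0 => /eqP h.
  by move/(congr1 rsubmx): h; rewrite row_mxKr linear0.
have [V' /andP[/eqP V'1 /andP[sV'U' sU'V']]] := IH _ freeU'.
pose w := u - u *m V'^T *m V'.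
have wV' : w *m V'^T = 0.
  by rewrite mulmxBl -[_ *m V' *m _]mulmxA V'1 mulmx1 subrr.
have uw : u = w + u *m V'^T *m V' by rewrite subrK.
have w0 : w != 0.
  apply/eqP => w0; move: uw; rewrite w0 add0r => uw.
  have /submxP[C uC] : (u <= U')%MS.
    by rewrite uw (submx_trans (submxMl _ _)).
  move: freeU; rewrite -kermx_eq0 => /eqP kU0.
  have : row_mx (1%:M : 'M_1) (- C) *m col_mx u U' = 0.
    by rewrite mul_row_col mul1mx mulNmx -uC subrr.
  move/sub_kermxP; rewrite kU0 submx0 => /eqP /(congr1 lsubmx).
  rewrite row_mxKl linear0 => /matrixP/(_ 0 0); rewrite !mxE eqxx.
  by move/eqP; rewrite oner_eq0.
pose c := (Num.sqrt ((w *m w^T) 0 0))^-1.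
have q0 := row_sqr_gt0 w0.
have c0 : c != 0 by rewrite invr_neq0 // gt_eqF // sqrtr_gt0.
have cw : (c *: w) *m (c *: w)^T = 1%:M.
  rewrite linearZ /= -scalemxAl -scalemxAr scalerA [w *m _]mx11_scalar.
  rewrite scale_scalar_mx -expr2 exprVn sqr_sqrtr ?ltW //.
  by rewrite mulVf // gt_eqF.
exists (col_mx (c *: w) V'); apply/andP; split.
  rewrite tr_col_mx mul_col_row cw V'1.
  rewrite -scalemxAl wV' scaler0.
  rewrite (_ : V' *m _ = 0) ?scalar_mx_block //.
  by apply: trmx_inj; rewrite trmx_mul trmxK -scalemxAl wV' scaler0 trmx0.
have sU : (u <= col_mx u U')%MS /\ (U' <= col_mx u U')%MS.
  by split; rewrite -addsmxE ?addsmxSl ?addsmxSr.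
have sV : (c *: w <= col_mx (c *: w) V')%MS /\ (V' <= col_mx (c *: w) V')%MS.
  by split; rewrite -addsmxE ?addsmxSl ?addsmxSr.
have sVU : (V' <= col_mx u U')%MS by apply: submx_trans sU.2.
have sUV : (U' <= col_mx (c *: w) V')%MS by apply: submx_trans sV.2.
have sw : (w <= col_mx (c *: w) V')%MS.
  by apply: submx_trans sV.1; rewrite (eqmx_scale _ c0).
apply/andP; split; rewrite col_mx_sub ?sVU ?sUV andbT.
  rewrite (eqmx_scale _ c0) addmx_sub ?sU.1 // eqmx_opp.
  by apply: submx_trans sVU; rewrite submxMl.
rewrite uw addmx_sub //.
by apply: submx_trans sV.2; rewrite submxMl.
Qed.

Lemma ex_orthonormal_basis m (E : 'M[R]_(m, n)) :
  exists V : 'M[R]_(\rank E, n), orthonormal_basis_of E V.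
Proof.
have [V /andP[V1 /eqmxP VE]] := gram_schmidt (row_base_free E).
exists V; rewrite /orthonormal_basis_of V1 /=; apply/eqmxP.
exact: eqmx_trans VE (eq_row_base E).
Qed.

Lemma orthonormal_basis_gram m (E : 'M[R]_(m, n)) k (V W : 'M[R]_(k, n)) :
  orthonormal_basis_of E V -> orthonormal_basis_of E W ->
  V^T *m V = W^T *m W.
Proof.
move=> /andP[/eqP V1 /eqmxP VE] /andP[/eqP W1 /eqmxP WE].
have /submxP[C VC] : (V <= W)%MS by rewrite VE WE.
have C1 : C *m C^T = 1%:M.
  by rewrite -V1 VC trmx_mul mulmxA -[C *m W *m _]mulmxA W1 mulmx1.
by rewrite VC trmx_mul mulmxA -[_ *m C^T *m C]mulmxA (mulmx1C C1) mulmx1.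
Qed.

End OrthonormalBasis.

Section EdgeDerivative.
Variables (R : rcfType) (n : nat) (e : rel 'I_n) (lambda : R).

Definition edge_derivative_in k (V : 'M[R]_(k, n)) (x y : 'I_n) : R :=
  k%:R^-1 * \sum_(i < k)
    ((1 - lambda) * (V i x ^+ 2 / (degree e x)%:R + V i y ^+ 2 / (degree e y)%:R)
     - 2 * (V i x * V i y / Num.sqrt ((degree e x)%:R * (degree e y)%:R))).

Definition lambda_eigenspace : 'M[R]_n :=
  eigenspace (normalized_laplacian R e) lambda.

(* The multiplicity k of lambda is \rank lambda_eigenspace. *)
Definition eigenbasis : 'M[R]_(\rank lambda_eigenspace, n) :=
  xchoose (ex_orthonormal_basis lambda_eigenspace).

Definition edge_derivative (x y : 'I_n) : R :=
  edge_derivative_in eigenbasis x y.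

Lemma edge_derivativeE (V : 'M[R]_(\rank lambda_eigenspace, n)) (x y : 'I_n) :
  orthonormal_basis_of lambda_eigenspace V ->
  edge_derivative x y = edge_derivative_in V x y.
Proof.
move=> Vb; have Bb := xchooseP (ex_orthonormal_basis lambda_eigenspace).
rewrite -/eigenbasis in Bb.
have gE a b : \sum_i eigenbasis i a * eigenbasis i b = \sum_i V i a * V i b.
  move/matrixP/(_ a b): (orthonormal_basis_gram Bb Vb); rewrite !mxE => h.
  transitivity (\sum_j eigenbasis^T a j * eigenbasis j b).
    by apply: eq_bigr => i _; rewrite mxE.
  by rewrite h; apply: eq_bigr => i _; rewrite mxE.
rewrite /edge_derivative /edge_derivative_in; congr (_ * _).
rewrite !sumrB -!mulr_sumr !big_split /= -!mulr_suml !gE.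
by congr (_ * (_ / _ + _ / _) - _); under eq_bigr do rewrite expr2; 
  rewrite gE; apply: eq_bigr => i _; rewrite expr2.
Qed.

End EdgeDerivative.

(* Main.v *)
(* Put f = D^{-1/2} v for a unit eigenvector v.  The term of v in the edge
   derivative is (1 - lambda) (f_x^2 + f_y^2) - 2 f_x f_y, that is
   (f_x - f_y)^2 - lambda (f_x^2 + f_y^2), or also
   (2 - lambda) (f_x^2 + f_y^2) - (f_x + f_y)^2.  As 0 <= lambda <= 2 and
   f_x^2 + f_y^2 <= v_x^2 + v_y^2 <= 1, each term, hence their average, lies in
   [- lambda, 2 - lambda].  On a single edge, the eigenvalues 0 and 2 (with
   f_x = f_y and f_x = - f_y respectively) attain the two bounds. *)
Require Import Defs.
From mathcomp Require Import all_boot all_order all_algebra.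
From mathcomp Require Import ring lra.
Set Implicit Arguments.
Unset Strict Implicit.
Unset Printing Implicit Defensive.
Import Order.TTheory GRing.Theory Num.Theory.
Local Open Scope ring_scope.

Section Spectrum.
Variables (R : rcfType) (n : nat) (e : rel 'I_n).

Local Notation L := (normalized_laplacian R e).
Local Notation w x := (Num.sqrt (degree e x)%:R : R)^-1.

Lemma mul_normalized_laplacianE (v : 'rV[R]_n) y :
  (v *m L) 0 y = v 0 y - (\sum_x v 0 x * w x * (e x y)%:R) * w y.
Proof.
rewrite /normalized_laplacian /inv_sqrt_degree_mx mulmxBr mulmx1 !mulmxA.
rewrite !mul_mx_diag !mxE; congr (_ - _ * _).
by apply: eq_bigr => x _; rewrite !mxE.
Qed.

Lemma sum_edge_degree x : \sum_y (e x y)%:R = (degree e x)%:R :> R.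
Proof.
rewrite -natr_sum /degree -sum1_card [in RHS]big_mkcond; congr (_ %:R).
by apply: eq_bigr => y _; rewrite inE; case: (e x y).
Qed.

(* An inequality only because of isolated vertices, where [w x = 0^-1 = 0]. *)
Lemma degree_inv_sqrt_le1 x : (degree e x)%:R * w x ^+ 2 <= 1.
Proof.
rewrite exprVn sqr_sqrtr ?ler0n //.
by have [->|d0] := eqVneq (degree e x) 0%N; rewrite ?mul0r ?ler01 // divff ?pnatr_eq0.
Qed.

(** With f = D^{-1/2} v, summing (f_x + s f_y)^2 over ordered adjacent pairs gives 2 (P + s T),
    where P = sum_x d_x f_x^2 <= S. The sign s = 1 or -1 is kept generic because each choice yields
    one end of the spectrum. *)
Lemma normalized_adjacency_form_ge (v : 'rV[R]_n) (s : R) :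
  symmetric e -> s ^+ 2 = 1 ->
  0 <= \sum_x v 0 x ^+ 2
       + s * \sum_y (\sum_x v 0 x * w x * (e x y)%:R) * w y * v 0 y.
Proof.
move=> esym s1; set S := \sum_x _ ^+ 2; set T := \sum_y _.
pose f x := v 0 x * w x; pose P := \sum_x (degree e x)%:R * f x ^+ 2.
have PS : P <= S.
  apply: ler_sum => x _; rewrite /f exprMn mulrCA ler_piMr ?sqr_ge0 //.
  exact: degree_inv_sqrt_le1.
have P1 : \sum_x \sum_y (e x y)%:R * f x ^+ 2 = P.
  by apply: eq_bigr => x _; rewrite -mulr_suml sum_edge_degree.
have P2 : \sum_x \sum_y (e x y)%:R * f y ^+ 2 = P.
  rewrite exchange_big -P1; apply: eq_bigr => x _; apply: eq_bigr => y _.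
  by rewrite esym.
have TE : T = \sum_x \sum_y (e x y)%:R * (f x * f y).
  rewrite exchange_big; apply: eq_bigr => y _; rewrite -mulrA mulr_suml.
  by apply: eq_bigr => x _; rewrite /f; ring.
have : 0 <= \sum_x \sum_y (e x y)%:R * (f x + s * f y) ^+ 2.
  by do 2![apply: sumr_ge0 => ? _]; rewrite mulr_ge0 ?ler0n ?sqr_ge0.
have -> : \sum_x \sum_y (e x y)%:R * (f x + s * f y) ^+ 2 =
          P + P + 2 * s * T.
  rewrite -{1}P1 -P2 TE mulr_sumr -!big_split; apply: eq_bigr => x _ /=.
  rewrite mulr_sumr -!big_split; apply: eq_bigr => y _ /=.
  by rewrite sqrrD [(s * _) ^+ 2]exprMn s1; ring.
by move=> h; lra.
Qed.

(** Pairing the eigenvector equation with v turns the adjacency form into (1 - lambda) S with S > 0;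
    then s = 1 gives lambda <= 2 and s = -1 gives 0 <= lambda. *)
Lemma normalized_laplacian_eigenvalue_bounds (lambda : R) :
  symmetric e -> eigenvalue L lambda -> 0 <= lambda <= 2.
Proof.
move=> esym /eigenvalueP[v vL v0].
set S := \sum_x v 0 x ^+ 2.
have S0 : 0 < S.
  rewrite /S; have := row_sqr_gt0 v0; rewrite mxE.
  by under eq_bigr do rewrite mxE -expr2.
have TE : \sum_y (\sum_x v 0 x * w x * (e x y)%:R) * w y * v 0 y
          = (1 - lambda) * S.
  rewrite mulr_sumr; apply: eq_bigr => y _.
  have := mul_normalized_laplacianE v y; rewrite vL mxE.
  by set t := (\sum_x _) * _ => h; have -> : t = v 0 y - lambda * v 0 y by [lra]; ring.
have h1 := normalized_adjacency_form_ge v esym (expr1n _ 2).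
have h2 := normalized_adjacency_form_ge v esym (etrans (sqrrN 1) (expr1n _ 2)).
rewrite TE -/S in h1 h2; rewrite -(pmulr_lge0 lambda S0) -(subr_ge0 lambda).
by rewrite -(pmulr_lge0 (2 - _) S0); apply/andP; split; lra.
Qed.

Lemma eigenbasis_eigenvector (lambda : R) i :
  row i (eigenbasis e lambda) *m L = lambda *: row i (eigenbasis e lambda).
Proof.
have /andP[_ /andP[sB _]] := xchooseP (ex_orthonormal_basis (lambda_eigenspace e lambda)).
by apply/eigenspaceP; apply: submx_trans sB; rewrite row_sub.
Qed.

Lemma eigenbasis_unit (lambda : R) i :
  \sum_x eigenbasis e lambda i x ^+ 2 = 1.
Proof.
have /andP[/eqP B1 _] := xchooseP (ex_orthonormal_basis (lambda_eigenspace e lambda)).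
move/matrixP/(_ i i): B1; rewrite !mxE eqxx mulr1n => <-.
by apply: eq_bigr => x _; rewrite mxE expr2.
Qed.

Lemma edge_derivative_inE (lambda : R) k (V : 'M[R]_(k, n)) x y :
  edge_derivative_in e lambda V x y =
  k%:R^-1 * \sum_i ((1 - lambda) * ((V i x * w x) ^+ 2 + (V i y * w y) ^+ 2)
                    - 2 * (V i x * w x * (V i y * w y))).
Proof.
congr (_ * _); apply: eq_bigr => i _.
by rewrite !exprMn !exprVn !sqr_sqrtr ?ler0n // sqrtrM ?ler0n // invfM; ring.
Qed.

Lemma edge_derivative_bounds (lambda : R) x y :
  symmetric e -> irreflexive e -> eigenvalue L lambda -> e x y ->
  - lambda <= edge_derivative e lambda x y <= 2 - lambda.
Proof.
move=> esym eirr Llam exy.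
have /andP[l0 l2] := normalized_laplacian_eigenvalue_bounds esym Llam.
have xy : y != x by apply: contraTneq exy => ->; rewrite eirr.
(* An endpoint of an edge has degree at least 1. *)
have w2 z t : e z t -> w z ^+ 2 <= 1.
  move=> ezt; rewrite exprVn sqr_sqrtr ?ler0n // invf_le1 ?ler1n ?ltr0n;
  by apply/card_gt0P; exists t; rewrite inE.
rewrite /edge_derivative edge_derivative_inE.
(* The average is over at least one vector, so its factor [k%:R^-1] is a genuine inverse. *)
have : \rank (lambda_eigenspace e lambda) != 0%N by rewrite mxrank_eq0.
move: (eigenbasis_unit (lambda := lambda)).
move: (eigenbasis e lambda); set k := \rank _ => B B1 k0.
have k0' : 0 < k%:R :> R by rewrite ltr0n lt0n.
have term i : - lambda <= (1 - lambda) * ((B i x * w x) ^+ 2 + (B i y * w y) ^+ 2)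
                    - 2 * (B i x * w x * (B i y * w y)) <= 2 - lambda.
  have le1 : (B i x * w x) ^+ 2 + (B i y * w y) ^+ 2 <= 1.
    (* As x and y are distinct, both squares split off from the unit norm of row i. *)
    rewrite -[leRHS](B1 i) (bigD1 x) //= (bigD1 y) //= addrA.
    rewrite ler_wpDr ?sumr_ge0 // => [z _|]; first exact: sqr_ge0.
    rewrite !exprMn lerD // ler_piMr ?sqr_ge0 //; first exact: w2 exy.
    by apply: (w2 _ x); rewrite esym.
  move: (B i x * _) (B i y * _) le1 => a b le1.
  (* With q = a^2 + b^2 <= 1, the two gaps are (a - b)^2 + lambda (1 - q) and (a + b)^2 + (2 -
     lambda) (1 - q). *)
  by apply/andP; split; have := sqr_ge0 (a - b); have := sqr_ge0 (a + b); nra.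
rewrite mulrC ler_pdivlMr // ler_pdivrMr //.
have cst (c : R) : c * k%:R = \sum_(i < k) c.
  by rewrite sumr_const card_ord mulr_natr.
by rewrite !cst; apply/andP; split; apply: ler_sum => i _; case/andP: (term i).
Qed.

End Spectrum.

Section SingleEdge.
Variable R : rcfType.

Definition single_edge : rel 'I_2 := [rel x y | x != y].

Lemma single_edge_connected : simple_connected_graph single_edge.
Proof.
split=> // [x y|x|x y]; first by rewrite /single_edge /= eq_sym.
  by rewrite /single_edge /= eqxx.
by have [->|xy] := eqVneq x y; [exact: connect0 | exact: connect1].
Qed.

(** On two vertices [rev_ord] is the swap, so it names the unique neighbour and collapses neighbour
    sums to one term. *)
Lemma single_edge_rev_ord x y : single_edge x y = (x == rev_ord y).
Proof. by case: x y => [[|[|i]] ?] [[|[|j]] ?]. Qed.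

Lemma single_edge_degree x : degree single_edge x = 1%N.
Proof.
rewrite -[RHS](card1 (rev_ord x)); apply: eq_card => y.
by rewrite !inE single_edge_rev_ord eq_sym (can2_eq rev_ordK rev_ordK).
Qed.

Lemma mul_single_edge_laplacian (v : 'rV[R]_2) y :
  (v *m normalized_laplacian R single_edge) 0 y = v 0 y - v 0 (rev_ord y).
Proof.
rewrite mul_normalized_laplacianE (bigD1 (rev_ord y)) //= big1 ?addr0 => [|x xy].
  by rewrite !single_edge_degree single_edge_rev_ord eqxx sqrtr1 invr1 !mulr1.
by rewrite single_edge_rev_ord (negPf xy) mulr0.
Qed.

Lemma single_edge_eigenvalue (s : R) :
  s ^+ 2 = 1 -> eigenvalue (normalized_laplacian R single_edge) (1 - s).
Proof.
(* The vector (1, s) is sent to (1 - s, s - 1), and s - 1 = (1 - s) s since s^2 = 1. *)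
move=> s1; apply/eigenvalueP; exists (\row_(i < 2) s ^+ i).
  apply/rowP=> y; rewrite mul_single_edge_laplacian !mxE.
  by case: y => [[|[|i]] ?] //=; rewrite ?expr0 ?expr1; ring: s1.
by apply/eqP => /rowP/(_ 0)/eqP; rewrite !mxE expr0 oner_eq0.
Qed.

(** Every eigenvector (a, b) for 1 - s has b = s a, so its term is s (a^2 + a^2) - 2 s a^2 = 0. *)
Lemma single_edge_derivative (s : R) :
  s ^+ 2 = 1 -> edge_derivative single_edge (1 - s) 0 1 = 0.
Proof.
move=> s1; rewrite /edge_derivative edge_derivative_inE big1 ?mulr0 // => i _.
have /rowP/(_ 0) := @eigenbasis_eigenvector R _ single_edge (1 - s) i.
rewrite mul_single_edge_laplacian !mxE (_ : rev_ord 0 = 1); last exact: val_inj.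
rewrite !single_edge_degree sqrtr1 invr1 !mulr1.
move: (eigenbasis _ _ i 0) (eigenbasis _ _ i 1) => a b ab.
have -> : b = s * a by lra.
by rewrite exprMn s1; ring.
Qed.

End SingleEdge.

Theorem theorem2p19 (R : rcfType) :
  [/\ forall (n : nat) (e : rel 'I_n) (lambda : R) (x y : 'I_n),
        simple_connected_graph e ->
        eigenvalue (normalized_laplacian R e) lambda ->
        e x y ->
        - lambda <= edge_derivative e lambda x y <= 2 - lambda,
      exists (n : nat) (e : rel 'I_n) (lambda : R) (x y : 'I_n),
        [/\ simple_connected_graph e,
            eigenvalue (normalized_laplacian R e) lambda,
            e x y
          & edge_derivative e lambda x y = - lambda]
    & exists (n : nat) (e : rel 'I_n) (lambda : R) (x y : 'I_n),
        [/\ simple_connected_graph e,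
            eigenvalue (normalized_laplacian R e) lambda,
            e x y
          & edge_derivative e lambda x y = 2 - lambda]].
Proof.
(* The value 0 is - lambda when s = 1 (lambda = 0) and 2 - lambda when s = -1 (lambda = 2). *)
have attained (s : R) : s ^+ 2 = 1 ->
    [/\ simple_connected_graph single_edge,
        eigenvalue (normalized_laplacian R single_edge) (1 - s),
        single_edge 0 1 & edge_derivative single_edge (1 - s) 0 1 = 0].
  move=> s1; split=> //; first exact: single_edge_connected.
    exact: single_edge_eigenvalue.
  exact: single_edge_derivative.
split.
- by move=> n e lambda x y [_ esym eirr _]; apply: edge_derivative_bounds.
- exists 2%N, single_edge, (1 - 1), 0, 1.
  have [gr ev xy ->] := attained 1 (expr1n _ 2).
  by split=> //; ring.
- exists 2%N, single_edge, (1 - -1), 0, 1.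
  have [gr ev xy ->] := attained (-1) (etrans (sqrrN 1) (expr1n _ 2)).
  by split=> //; ring.
Qed.
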